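(* Let $A,B,C,D\in\mathbb{C}^{m\times n}$ and assume that each of the equations $AX=B$ and $CY=D$ has a Hermitian solution. Put $$\mathcal{S}=\{X\in\mathbb{C}^{n}_{\mathrm H}\mid AX=B\},\qquad \mathcal{T}=\{Y\in\mathbb{C}^{n}_{\mathrm H}\mid CY=D\},$$ $$M=\begin{bmatrix} AB^* & 0 & A \\ 0 & -CD^* & C \\ A^* & C^* & 0 \end{bmatrix},\qquad N=\begin{bmatrix} A & B \\ C & D \end{bmatrix}.$$ Then $$\max_{X\in\mathcal{S},\,Y\in\mathcal{T}}r(X-Y)=n+r(N)-r(A)-r(C),$$ $$\min_{X\in\mathcal{S},\,Y\in\mathcal{T}}r(X-Y)=2r(N)+r(AD^*-BC^* )-r\begin{bmatrix} A & BA^* \\ C & DA^* \end{bmatrix}-r\begin{bmatrix} A & BC^* \\ C & DC^* \end{bmatrix},$$ $$\max_{X\in\mathcal{S},\,Y\in\mathcal{T}}i_{\pm}(X-Y)=n+i_{\pm}(M)-r(A)-r(C),$$ $$\min_{X\in\mathcal{S},\,Y\in\mathcal{T}}i_{\pm}(X-Y)=r(N)-i_{\mp}(M).$$ In consequence: (a) There exist $X\in\mathcal{S}$ and $Y\in\mathcal{T}$ such that $X-Y$ is nonsingular if and only if $r(N)=r(A)+r(C)$. (b) $X-Y$ is nonsingular for all $X\in\mathcal{S}$ and $Y\in\mathcal{T}$ if and only if $$2r(N)+r(AD^*-BC^* )=r\begin{bmatrix} A & BA^* \\ C & DA^* \end{bmatrix}+r\begin{bmatrix} A & BC^* \\ C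 & DC^* \end{bmatrix}+n.$$ (c) $\mathcal{S}\cap\mathcal{T}\neq\emptyset$ if and only if $$\mathscr{R}\begin{bmatrix} B \\ D \end{bmatrix}\subseteq\mathscr{R}\begin{bmatrix} A \\ C \end{bmatrix}\quad\text{and}\quad\begin{bmatrix} A \\ C \end{bmatrix}[\,B^*,\ D^*\,]=\begin{bmatrix} B \\ D \end{bmatrix}[\,A^*,\ C^*\,].$$ (d) There exist $X\in\mathcal{S}$ and $Y\in\mathcal{T}$ with $X\succ Y$ (respectively $X\prec Y$) if and only if $i_+(M)=r(A)+r(C)$ (respectively $i_-(M)=r(A)+r(C)$). (e) $X\succ Y$ (respectively $X\prec Y$) for all $X\in\mathcal{S}$ and $Y\in\mathcal{T}$ if and only if $i_-(M)=r(N)-n$ (respectively $i_+(M)=r(N)-n$). (f) There exist $X\in\mathcal{S}$ and $Y\in\mathcal{T}$ with $X\succcurlyeq Y$ (respectively $X\preccurlyeq Y$) if and only if $i_+(M)=r(N)$ (respectively $i_-(M)=r(N)$). (g) $X\succcurlyeq Y$ (respectively $X\preccurlyeq Y$) for all $X\in\mathcal{S}$ and $Y\in\mathcal{T}$ if and only if $i_-(M)=r(A)+r(C)-n$ (respectively $i_+(M)=r(A)+r(C)-n$).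
   Context: $\mathbb{C}^{n}_{\mathrm H}$ is the set of $n\times n$ complex Hermitian matrices. $A^*$, $r(A)$ and $\mathscr{R}(A)$ denote the conjugate transpose, rank and range (column space) of $A$. For Hermitian $H$, $i_+(H)$ and $i_-(H)$ are the numbers of positive and negative eigenvalues of $H$ counted with multiplicity; a formula with $i_{\pm}$ and $i_{\mp}$ stands for two formulas, one with all upper signs and one with all lower signs. For Hermitian $H,K$ of the same size, $H\succcurlyeq K$ ($H\succ K$) means $H-K$ is Hermitian positive semidefinite (positive definite); $H\preccurlyeq K$, $H\prec K$ mean $K\succcurlyeq H$, $K\succ H$. (Solvability by Hermitian matrices forces $AB^*$ and $CD^*$ to be Hermitian, so $M$ is Hermitian.) *)

(* Defs.v *)
From mathcomp Require Export all_boot all_order all_algebra.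
From mathcomp Require Export classical_sets reals complex.

Set Implicit Arguments.
Unset Strict Implicit.
Unset Printing Implicit Defensive.

Import Order.TTheory GRing.Theory Num.Theory.

Local Open Scope classical_set_scope.
Local Open Scope ring_scope.
Local Open Scope sesquilinear_scope.

Definition eigenvals (F : closedFieldType) (n : nat) (H : 'M[F]_n) : seq F :=
  sval (closed_field_poly_normal (char_poly H)).

(* In the order of a numClosedFieldType, 0 < z means that z is real and
   positive; the eigenvalues of a Hermitian matrix are real. *)
Definition ipos (F : numClosedFieldType) (n : nat) (H : 'M[F]_n) : nat :=
  count (fun z : F => 0 < z) (eigenvals H).

Definition ineg (F : numClosedFieldType) (n : nat) (H : 'M[F]_n) : nat :=
  count (fun z : F => z < 0) (eigenvals H).

Definition psdmx (F : numClosedFieldType) (n : nat) (H : 'M[F]_n) : Prop :=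
  H \is hermsymmx /\ forall v : 'cV[F]_n, 0 <= (v ^t* *m H *m v) 0 0.

Definition pdmx (F : numClosedFieldType) (n : nat) (H : 'M[F]_n) : Prop :=
  H \is hermsymmx /\
  forall v : 'cV[F]_n, v != 0 -> 0 < (v ^t* *m H *m v) 0 0.

(* (A <= B)%MS compares row spaces; this is the column space. *)
Definition colrange (F : fieldType) (m n : nat) (A : 'M[F]_(m, n)) :
  set 'cV[F]_m := range (fun x : 'cV[F]_n => A *m x).

Definition hermsol (F : numClosedFieldType) (m n : nat) (A B : 'M[F]_(m, n)) :
  set 'M[F]_n := [set X | X \is hermsymmx /\ A *m X = B].

Definition Mmx (F : numClosedFieldType) (m n : nat) (A B C D : 'M[F]_(m, n)) :
  'M[F]_(m + m + n) :=
  block_mx (block_mx (A *m B ^t*) 0 0 (- (C *m D ^t*))) (col_mx A C)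
           (row_mx (A ^t*) (C ^t*))                     0.

(* The values f takes on the differences X - Y, as integers, so that the
   subtractions in the extremal formulas are not truncated. *)
Definition diffvals (F : fieldType) (n : nat) (S T : set 'M[F]_n)
    (f : 'M[F]_n -> nat) : set int :=
  [set k | exists X Y, [/\ S X, T Y & k = (f (X - Y))%:Z]].

Definition is_max (E : set int) (k : int) : Prop := E k /\ ubound E k.
Definition is_min (E : set int) (k : int) : Prop := E k /\ lbound E k.

(* Main.v *)
Require Import Defs.
From mathcomp Require Import zify.

Set Implicit Arguments.
Unset Strict Implicit.
Unset Printing Implicit Defensive.

Import Order.TTheory GRing.Theory Num.Theory.
Local Open Scope classical_set_scope.
Local Open Scope ring_scope.
Local Open Scope sesquilinear_scope.

(** Fix Hermitian solutions X0 and Y0, put G = X0 - Y0, and let J span the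
    intersection of the row spaces of A and C. Every difference Z = X - Y
    satisfies J Z = J G and A Z C^t* = A G C^t*; conversely Z may be changed by
    K1 - K2 for any Hermitian K1, K2 with A K1 = 0 and C K2 = 0. Write d for the
    rank of J, r for that of J G, and (p, q) for the inertia of J G J^t*, all of
    which are the same for G and for Z.

    The matrices in the statement are expressed in these terms. Let rho be the
    rank of the stacked matrix of A and C, so that rho + d = r(A) + r(C). Up
    to congruence and a zero block, M consists of rho hyperbolic planes and the
    restriction of G to J, hence M has inertia (rho + p, rho + q) ([ipos_Mmx],
    [ineg_Mmx]); row elimination gives r(N) = rho + r, and likewise the two
    other block matrices have rank rho plus the rank of J G A^t*, respectively
    of J G C^t* ([rank_coupled]). So the claims are that i_+(Z) ranges between
    r - q and n - d + p (exchange p and q for i_-), that the rank of Z is at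
    most n - d + r, and that it is at least
    2 r + r(A G C^t* ) - r(J G A^t* ) - r(J G C^t* ).

    The bounds hold for each Z separately. The upper ones are interlacing
    ([ipos_codim]), since J Z J^t* has inertia (p, q). The lower bound for the
    inertia is [rank_le_ipos_ineg], and the lower bound for the rank is the
    Frobenius inequality used twice ([coupled_rank_ge]).

    One perturbation attains all bounds but the last. For K = K1 - K2 positive
    semidefinite with kernel exactly J, and t large, G + t K has at least
    n - d + p positive eigenvalues ([ipos_perturb], [max_ipos_coupled]). Its
    rank is at most n - d + r, so i_- is at most r - p, and the bounds show that
    i_+ is maximal, i_- minimal and the rank maximal at the same time; G - t K
    gives the two remaining inertias. The minimal rank is reached by
    an explicit construction ([min_rank_coupled]): after splitting off the part
    of Z fixed by J, only one off-diagonal block is prescribed, and a Hermitian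
    matrix with a prescribed off-diagonal block can have the rank of the block.

    Parts (a), (b) and (d) to (g) read off when an extremal value is 0 or n.
    Part (c) is the solvability of the stacked equation by a Hermitian
    matrix ([hermsol_exists]). *)

(** * Conjugate transposes and Hermitian matrices *)

Lemma trmxC_mul (F : numClosedFieldType) m n p (A : 'M[F]_(m, n))
  (B : 'M[F]_(n, p)) : (A *m B) ^t* = B ^t* *m A ^t*.
Proof. by rewrite trmx_mul map_mxM. Qed.

Lemma trmxC_add (F : numClosedFieldType) m n (A B : 'M[F]_(m, n)) :
  (A + B) ^t* = A ^t* + B ^t*.
Proof. by rewrite linearD map_mxD. Qed.

Lemma trmxC_opp (F : numClosedFieldType) m n (A : 'M[F]_(m, n)) :
  (- A) ^t* = - A ^t*.
Proof. by rewrite linearN map_mxN. Qed.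

Lemma trmxC_sub (F : numClosedFieldType) m n (A B : 'M[F]_(m, n)) :
  (A - B) ^t* = A ^t* - B ^t*.
Proof. by rewrite trmxC_add trmxC_opp. Qed.

Lemma trmxC0 (F : numClosedFieldType) m n : (0 : 'M[F]_(m, n)) ^t* = 0.
Proof. by rewrite trmx0 map_mx0. Qed.

Lemma trmxC1 (F : numClosedFieldType) n : (1%:M : 'M[F]_n) ^t* = 1%:M.
Proof. by rewrite trmx1 map_mx1. Qed.

Lemma trmxC_row_mx (F : numClosedFieldType) m n p (A : 'M[F]_(m, n))
  (B : 'M[F]_(m, p)) : (row_mx A B) ^t* = col_mx (A ^t*) (B ^t*).
Proof. by rewrite tr_row_mx map_col_mx. Qed.

Lemma trmxC_col_mx (F : numClosedFieldType) m n p (A : 'M[F]_(m, n))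
  (B : 'M[F]_(p, n)) : (col_mx A B) ^t* = row_mx (A ^t*) (B ^t*).
Proof. by rewrite tr_col_mx map_row_mx. Qed.

Lemma trmxC_block_mx (F : numClosedFieldType) m1 m2 n1 n2
  (A : 'M[F]_(m1, n1)) (B : 'M[F]_(m1, n2)) (C : 'M[F]_(m2, n1))
  (D : 'M[F]_(m2, n2)) :
  (block_mx A B C D) ^t* = block_mx (A ^t*) (C ^t*) (B ^t*) (D ^t*).
Proof. by rewrite tr_block_mx map_block_mx. Qed.

Lemma trmxC_scale (F : numClosedFieldType) m n (a : F) (A : 'M[F]_(m, n)) :
  a \is Num.real -> (a *: A) ^t* = a *: A ^t*.
Proof. by move=> ra; rewrite linearZ /= map_mxZ /= (CrealP ra). Qed.

Lemma hermE (F : numClosedFieldType) n (H : 'M[F]_n) :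
  reflect (H ^t* = H) (H \is hermsymmx).
Proof.
by apply: (iffP (is_hermitianmxP _ _ _)); rewrite expr0 scale1r => hH;
  exact/esym.
Qed.

Lemma hermD (F : numClosedFieldType) n (H K : 'M[F]_n) :
  H \is hermsymmx -> K \is hermsymmx -> H + K \is hermsymmx.
Proof. by move=> /hermE hH /hermE hK; apply/hermE; rewrite trmxC_add hH hK. Qed.

Lemma hermN (F : numClosedFieldType) n (H : 'M[F]_n) :
  H \is hermsymmx -> - H \is hermsymmx.
Proof. by move=> /hermE hH; apply/hermE; rewrite trmxC_opp hH. Qed.

Lemma hermB (F : numClosedFieldType) n (H K : 'M[F]_n) :
  H \is hermsymmx -> K \is hermsymmx -> H - K \is hermsymmx.
Proof. by move=> hH hK; rewrite hermD ?hermN. Qed.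

Lemma herm_congr (F : numClosedFieldType) m n (J : 'M[F]_(m, n)) (H : 'M[F]_n) :
  H \is hermsymmx -> J *m H *m J ^t* \is hermsymmx.
Proof.
by move=> /hermE hH; apply/hermE; rewrite !trmxC_mul trmxCK hH mulmxA.
Qed.

Lemma herm_conj (F : numClosedFieldType) m p n (H : 'M[F]_n)
    (x : 'M[F]_(m, n)) (y : 'M[F]_(p, n)) :
  H \is hermsymmx -> (x *m H *m y ^t*) ^t* = y *m H *m x ^t*.
Proof. by move=> /hermE hH; rewrite !trmxC_mul trmxCK hH mulmxA. Qed.

Lemma herm_gram (F : numClosedFieldType) m n (N : 'M[F]_(m, n)) :
  N *m N ^t* \is hermsymmx.
Proof. by apply/hermE; rewrite trmxC_mul trmxCK. Qed.

(** * Hermitian forms and their inertia *)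

Definition qf (F : numClosedFieldType) n (H : 'M[F]_n) (x : 'rV[F]_n) : F :=
  (x *m H *m x ^t*) 0 0.

Definition posdef_on (F : numClosedFieldType) m n (H : 'M[F]_n)
  (V : 'M[F]_(m, n)) : Prop :=
  forall x : 'rV[F]_n, (x <= V)%MS -> x != 0 -> 0 < qf H x.

Lemma qf_mul (F : numClosedFieldType) m n (J : 'M[F]_(m, n)) (H : 'M[F]_n) x :
  qf H (x *m J) = qf (J *m H *m J ^t*) x.
Proof. by rewrite /qf trmxC_mul !mulmxA. Qed.

Lemma qfD (F : numClosedFieldType) n (H K : 'M[F]_n) x :
  qf (H + K) x = qf H x + qf K x.
Proof. by rewrite /qf mulmxDr mulmxDl mxE. Qed.

Lemma qfN (F : numClosedFieldType) n (H : 'M[F]_n) x :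
  qf (- H) x = - qf H x.
Proof. by rewrite /qf mulmxN mulNmx mxE. Qed.

Lemma qfZ (F : numClosedFieldType) n (a : F) (H : 'M[F]_n) x :
  qf (a *: H) x = a * qf H x.
Proof. by rewrite /qf -scalemxAr -scalemxAl mxE. Qed.

Lemma qf0 (F : numClosedFieldType) n (H : 'M[F]_n) : qf H 0 = 0.
Proof. by rewrite /qf !mul0mx mxE. Qed.

Lemma qfD_orth (F : numClosedFieldType) n (H : 'M[F]_n) (x y : 'rV[F]_n) :
  H \is hermsymmx -> x *m H *m y ^t* = 0 -> qf H (x + y) = qf H x + qf H y.
Proof.
move=> hH xy; have yx : y *m H *m x ^t* = 0.
  by rewrite -(herm_conj _ _ hH) xy trmxC0.
by rewrite /qf trmxC_add !mulmxDl !mulmxDr xy yx addr0 add0r mxE.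
Qed.

Lemma qf1 (F : numClosedFieldType) n (x : 'rV[F]_n) :
  qf 1%:M x = \sum_i `|x 0 i| ^+ 2.
Proof.
rewrite /qf mulmx1 mxE; apply: eq_bigr => i _.
by rewrite !mxE -normCK.
Qed.

Lemma qf1_eq0 (F : numClosedFieldType) n (x : 'rV[F]_n) :
  (qf 1%:M x == 0) = (x == 0).
Proof.
apply/eqP/eqP => [|->]; last by rewrite qf0.
rewrite qf1 => /psumr_eq0P => x0; apply/rowP => i; rewrite mxE.
apply/eqP; rewrite -normr_eq0 -sqrf_eq0 x0 // => j _.
by rewrite exprn_ge0.
Qed.

Lemma qf1_ge0 (F : numClosedFieldType) n (x : 'rV[F]_n) : 0 <= qf 1%:M x.
Proof. by rewrite qf1 sumr_ge0 // => i _; rewrite exprn_ge0. Qed.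

Lemma qf_gram (F : numClosedFieldType) n p (N : 'M[F]_(n, p)) (x : 'rV[F]_n) :
  qf (N *m N ^t*) x = qf 1%:M (x *m N).
Proof. by rewrite /qf mulmx1 trmxC_mul !mulmxA. Qed.

Lemma spectral_decomposition (F : numClosedFieldType) n (H : 'M[F]_n) :
  H \is hermsymmx ->
  exists P : 'M[F]_n, exists d : 'rV[F]_n,
    [/\ P \is unitarymx, forall i, d 0 i \is Num.real
      & H = P ^t* *m diag_mx d *m P].
Proof.
move=> hH; exists (spectralmx H), (spectral_diag H); split.
- exact: spectral_unitarymx.
- by move=> i; have /mxOverP := hermitian_spectral_diag_real hH.
- rewrite -invmx_unitary ?spectral_unitarymx //.
  exact/orthomx_spectralP/hermitian_normalmx.
Qed.

Lemma char_poly_unitary_conj (F : numClosedFieldType) n (P : 'M[F]_n)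
    (d : 'rV[F]_n) : P \is unitarymx ->
  char_poly (P ^t* *m diag_mx d *m P) = \prod_i ('X - (d 0 i)%:P).
Proof.
move=> uP; have PP : P ^t* *m P = 1%:M.
  by rewrite -invmx_unitary // mulVmx // unitarymx_unit.
have -> : \prod_i ('X - (d 0 i)%:P) = char_poly (diag_mx d).
  rewrite char_poly_trig ?diag_mx_is_trig //.
  by apply: eq_bigr => i _; rewrite mxE eqxx.
have PP' : map_mx polyC (P ^t*) *m map_mx polyC P = 1%:M.
  by rewrite -map_mxM PP map_mx1.
rewrite /char_poly /char_poly_mx !map_mxM /=.
rewrite -[X in X - _]mulmx1 -PP' mulmxA -scalar_mxC -mulmxBl.
rewrite -mulmxBr !det_mulmx mulrAC -det_mulmx PP' det1 mul1r //.
Qed.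

(** This ties the inertia, defined through the roots of the characteristic
    polynomial, to any unitary diagonalisation of the matrix. *)
Lemma count_eigenvals (F : numClosedFieldType) n (P : 'M[F]_n)
    (d : 'rV[F]_n) (a : pred F) : P \is unitarymx ->
  count a (eigenvals (P ^t* *m diag_mx d *m P)) = #|[pred i | a (d 0 i)]|.
Proof.
move=> uP; rewrite /eigenvals.
case: closed_field_poly_normal => /= r.
rewrite (monicP (char_poly_monic _)) scale1r char_poly_unitary_conj //.
rewrite -(big_map (fun i => d 0 i) xpredT (fun z => 'X - z%:P)).
move=> /prod_XsubC_eq /permP <-.
by rewrite count_map cardE size_filter [index_enum _]unlock.
Qed.

(** Vectors are handled through their coordinates z in the eigenbasis P, where
    a form is diagonal and its sign can be read off the support of z. *)
Lemma eigenspan (F : numClosedFieldType) n (P : 'M[F]_n) (d : 'rV[F]_n)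
    (s : pred 'I_n) : P \is unitarymx ->
  exists V : 'M[F]_n, \rank V = #|s| /\
    forall x : 'rV[F]_n, (x <= V)%MS ->
      exists2 z : 'rV[F]_n, x = z *m P & forall i, ~~ s i -> z 0 i = 0.
Proof.
move=> uP; pose E : 'M[F]_(#|s|, n) := rowsub (@enum_val _ s) 1%:M.
have uE : E \is unitarymx.
  apply/unitarymxP/matrixP => i j; rewrite !mxE.
  rewrite (bigD1 (enum_val i)) //= big1 ?addr0.
    rewrite !mxE eqxx mul1r (inj_eq enum_val_inj) eq_sym.
    by rewrite rmorph_nat.
  by move=> k /negPf nk; rewrite !mxE eq_sym nk mul0r.
exists <<E *m P>>%MS; rewrite genmxE mxrank_unitary ?mul_unitarymx //.
split=> // x; rewrite genmxE => /submxP[y ->]; exists (y *m E);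
  rewrite ?mulmxA // => i si.
rewrite mxE big1 // => k _; rewrite !mxE.
case: eqP => [ei|]; last by rewrite mulr0.
by move: (enum_valP k); rewrite ei unfold_in (negPf si).
Qed.

Lemma qf_spectral (F : numClosedFieldType) n (P : 'M[F]_n) (d : 'rV[F]_n) z :
  P \is unitarymx ->
  qf (P ^t* *m diag_mx d *m P) (z *m P) = \sum_i d 0 i * `|z 0 i| ^+ 2.
Proof.
move=> /unitarymxP uP; rewrite qf_mul !mulmxA uP mul1mx -mulmxA uP mulmx1.
rewrite /qf mxE; apply: eq_bigr => i _.
by rewrite mul_mx_diag !mxE mulrAC -normCK mulrC.
Qed.

Lemma rank_spectral (F : numClosedFieldType) n (P : 'M[F]_n) (d : 'rV[F]_n) :
  P \is unitarymx -> (forall i, d 0 i \is Num.real) ->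
  \rank (P ^t* *m diag_mx d *m P) =
   addn #|[pred i | 0 < d 0 i]| #|[pred i | d 0 i < 0]|.
Proof.
move=> uP rd; set D := diag_mx d.
have uI : (1%:M : 'M[F]_n) \is unitarymx.
  by apply/unitarymxP; rewrite trmxC1 mulmx1.
have -> : \rank (P ^t* *m D *m P) = \rank D.
  rewrite mxrankMfree ?row_free_unit ?unitarymx_unit //.
  by rewrite eqmxMfull // row_full_unit unitarymx_unit // trmxC_unitary.
pose s := [pred i | d 0 i != 0].
have -> : addn #|[pred i | 0 < d 0 i]| #|[pred i | d 0 i < 0]| = #|s|.
  rewrite -cardUI [X in (_ + X)%N]eq_card0 ?addn0; last first.
    by move=> i; rewrite !inE; apply/andP => -[/lt_trans h /h]; rewrite ltxx.
  by apply: eq_card => i; rewrite !inE orbC -real_neqr_lt ?rd // real0.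
have [V [rV hV]] := eigenspan d s uI.
have [K [rK hK]] := eigenspan d (predC s) uI.
apply/eqP; rewrite eqn_leq; apply/andP; split.
  have : (K <= kermx D)%MS.
    apply/rV_subP => x /hK[z ->]; rewrite mulmx1 => hz.
    apply/sub_kermxP; rewrite mul_mx_diag; apply/rowP => i; rewrite !mxE.
    have [/eqP ->|ni] := boolP (d 0 i == 0); first by rewrite mulr0.
    by rewrite hz ?mul0r //= negbK.
  move=> /mxrankS; rewrite mxrank_ker rK.
  have -> : #|s| = (n - \rank K)%N.
    by rewrite rK -[X in subn X]card_ord -(cardC s) addnK.
  have := rank_leq_row D; have := rank_leq_row K; rewrite -rK; lia.
rewrite -rV -(mxrank_mul_ker V D).
suff -> : \rank (V :&: kermx D)%MS = 0%N by rewrite addn0 mxrankM_maxr.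
apply/eqP; rewrite mxrank_eq0 -submx0; apply/rV_subP => x.
rewrite sub_capmx => /andP[/hV[z ->]]; rewrite mulmx1 => hz /sub_kermxP.
rewrite mul_mx_diag => /rowP h; suff -> : z = 0 by rewrite sub0mx.
apply/rowP => i; have := h i; rewrite !mxE => /eqP.
have [si|nsi] := boolP (s i); last by rewrite hz.
by rewrite mulf_eq0 (negPf (si : d 0 i != 0)) orbF => /eqP.
Qed.

Section Inertia.
Variables (F : numClosedFieldType) (n : nat).
Implicit Types (H : 'M[F]_n).

Lemma inegE H : H \is hermsymmx -> ineg H = ipos (- H).
Proof.
move=> /spectral_decomposition[P [d [uP rd ->]]].
rewrite -mulNmx -mulmxN -linearN /= /ineg /ipos.
rewrite !(@count_eigenvals _ _ P _ _ uP) //.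
by apply: eq_card => i; rewrite !inE mxE oppr_gt0.
Qed.

Lemma iposDineg H : H \is hermsymmx -> (ipos H + ineg H)%N = \rank H.
Proof.
move=> /spectral_decomposition[P [d [uP rd ->]]].
by rewrite /ineg /ipos !count_eigenvals // rank_spectral.
Qed.

(** The span of the eigenvectors of positive eigenvalues is positive definite.
    With [posdef_rank] below, this makes ipos the largest rank of a positive
    definite subspace. *)
Lemma posdef_subspace H : H \is hermsymmx ->
  exists V : 'M[F]_n, posdef_on H V /\ \rank V = ipos H.
Proof.
move=> /spectral_decomposition[P [d [uP rd ->]]].
rewrite /ipos count_eigenvals //; set s := [pred i | _].
have [V [rV hV]] := eigenspan d s uP.
exists V; rewrite rV; split=> // x /hV[z -> hz] nz; rewrite qf_spectral //.
have [i zi] : exists i, z 0 i != 0.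
  by apply/rV0Pn; apply: contraNneq nz => ->; rewrite mul0mx eqxx.
have pos j : 0 <= d 0 j * `|z 0 j| ^+ 2.
  have [sj|nsj] := boolP (0 < d 0 j); last by rewrite hz // normr0 expr0n mulr0.
  by rewrite mulr_ge0 ?exprn_ge0 // ltW.
rewrite lt_def sumr_ge0 ?andbT; last by move=> j _; exact: pos.
apply: contraNneq zi => /psumr_eq0P h.
have /eqP := h (fun i _ => pos i) i isT.
have [sj|nsj] := boolP (0 < d 0 i); last by rewrite hz.
by rewrite mulf_eq0 gt_eqF // sqrf_eq0 normr_eq0.
Qed.

(** The complementary eigenspan. Beyond being negative semidefinite, it meets
    the isotropic vectors only in the radical of H, which a general maximal
    nonpositive subspace need not do; [rank_le_ipos_ineg] depends on this. *)
Lemma nonpos_subspace H : H \is hermsymmx ->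
  exists W : 'M[F]_n, \rank W = (n - ipos H)%N /\
   forall x : 'rV[F]_n, (x <= W)%MS ->
     qf H x <= 0 /\ (qf H x = 0 -> x *m H = 0).
Proof.
move=> /spectral_decomposition[P [d [uP rd ->]]].
rewrite /ipos count_eigenvals //; set s := [pred i | _].
have [V [rV hV]] := eigenspan d (predC s) uP.
exists V; rewrite rV; split=> [|x].
  by rewrite -[X in subn X]card_ord -(cardC s) addKn.
move=> /hV[z -> hz]; rewrite qf_spectral //.
have neg j : d 0 j * `|z 0 j| ^+ 2 <= 0.
  have [sj|nsj] := boolP (0 < d 0 j).
    by rewrite hz /= ?sj // normr0 expr0n mulr0.
  rewrite mulr_le0_ge0 ?exprn_ge0 //.
  by rewrite real_leNgt ?rd.
split; first by rewrite sumr_le0.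
move=> /eqP; rewrite -oppr_eq0 -sumrN => /eqP/psumr_eq0P h.
move/unitarymxP: uP => uP; rewrite !mulmxA -(mulmxA z) uP mulmx1.
suff -> : z *m diag_mx d = 0 by rewrite mul0mx.
rewrite mul_mx_diag; apply/rowP => i; rewrite !mxE.
have /eqP : - (d 0 i * `|z 0 i| ^+ 2) = 0.
  by apply: h => // j _; rewrite oppr_ge0.
by rewrite oppr_eq0 mulf_eq0 sqrf_eq0 normr_eq0 => /orP[] /eqP ->;
   rewrite ?mulr0 ?mul0r.
Qed.

End Inertia.

(** * Inertia of restricted forms *)

(* Equal ranks may be spelt with different paths through the algebraic
   hierarchy; naming them up to conversion lets lia see one variable. *)
Ltac name_nat t := let x := fresh "k" in set x := t; clearbody x.
Ltac rank_lia :=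
  repeat match goal with
  | |- context [@mxrank.body ?F ?m ?n ?A] => name_nat (@mxrank.body F m n A)
  | |- context [@ipos ?F ?n ?H] => name_nat (@ipos F n H)
  | |- context [@ineg ?F ?n ?H] => name_nat (@ineg F n H)
  end; lia.

Section Restriction.
Variable F : numClosedFieldType.

(** A positive definite subspace meets the nonpositive eigenspan trivially, so
    the two dimensions add up to at most n. *)
Lemma posdef_rank n (H : 'M[F]_n) m (V : 'M[F]_(m, n)) :
  H \is hermsymmx -> posdef_on H V -> (\rank V <= ipos H)%N.
Proof.
move=> hH pV; have [W [rW hW]] := nonpos_subspace hH.
have VW0 : (V :&: W)%MS = 0.
  apply/eqP; rewrite -submx0; apply/rV_subP => x; rewrite sub_capmx.
  move=> /andP[/pV xV /hW[xW _]]; rewrite submx0; apply/negPn/negP => /xV.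
  by move=> /lt_le_trans /(_ xW); rewrite ltxx.
have := rank_leq_col (V + W)%MS; rewrite (mxrank_disjoint_sum VW0) rW.
by have := rank_leq_row V; lia.
Qed.

(** Subspaces of the row space of J lift, through a pseudo-inverse of J, to
    subspaces on which the restricted form J H J^* takes the same values. *)
Lemma posdef_restrict_rank n (H : 'M[F]_n) m p (J : 'M[F]_(m, n))
    (V : 'M[F]_(p, n)) :
  H \is hermsymmx -> (V <= J)%MS -> posdef_on H V ->
  (\rank V <= ipos (J *m H *m J ^t*))%N.
Proof.
move=> hH sVJ pV; pose U := V *m pinvmx J.
have UJ : U *m J = V by rewrite mulmxKpV.
have pU : posdef_on (J *m H *m J ^t*) U.
  move=> x /submxP[y xE] nx; rewrite -qf_mul; apply: pV.
    by rewrite xE -mulmxA UJ submxMl.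
  apply: contraNneq nx => xJ0.
  have <- : x *m J *m pinvmx J = x by rewrite xE -(mulmxA y U J) UJ -mulmxA.
  by rewrite xJ0 mul0mx.
apply: leq_trans (posdef_rank (herm_congr J hH) pU).
by rewrite -{1}UJ mxrankM_maxl.
Qed.

Lemma restrict_posdef_subspace n (H : 'M[F]_n) m (J : 'M[F]_(m, n)) :
  H \is hermsymmx -> exists V : 'M[F]_n,
    [/\ (V <= J)%MS, posdef_on H V & \rank V = ipos (J *m H *m J ^t*)].
Proof.
move=> hH; have [U [pU rU]] := posdef_subspace (herm_congr J hH).
exists <<U *m J>>%MS; rewrite !genmxE submxMl; split=> //.
  move=> x; rewrite genmxE => /submxP[y ->]; rewrite mulmxA => nx.
  rewrite qf_mul pU ?submxMl //.
  by apply: contraNneq nx => ->; rewrite mul0mx.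
rewrite -rU -(mxrank_mul_ker U J).
suff -> : \rank (U :&: kermx J)%MS = 0%N by rewrite addn0.
apply/eqP; rewrite mxrank_eq0 -submx0; apply/rV_subP => x.
rewrite sub_capmx submx0 => /andP[/pU xU /sub_kermxP xJ].
by apply/negPn/negP => /xU; rewrite -qf_mul xJ qf0 ltxx.
Qed.

(** In particular ipos (J H J^t* ) depends only on the row space of J. This is
    the form in which Sylvester's law of inertia is used. *)
Lemma ipos_congr_sub n (H : 'M[F]_n) m p (J : 'M[F]_(m, n)) (K : 'M[F]_(p, n)) :
  H \is hermsymmx -> (J <= K)%MS ->
  (ipos (J *m H *m J ^t*) <= ipos (K *m H *m K ^t*))%N.
Proof.
move=> hH sJK; have [V [sVJ pV <-]] := restrict_posdef_subspace J hH.
exact: posdef_restrict_rank (submx_trans sVJ sJK) pV.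
Qed.

Lemma ipos_congr_le n (H : 'M[F]_n) m (J : 'M[F]_(m, n)) :
  H \is hermsymmx -> (ipos (J *m H *m J ^t*) <= ipos H)%N.
Proof.
move=> hH; have := ipos_congr_sub hH (submx1 J).
by rewrite trmxC1 mul1mx mulmx1.
Qed.

(** Cauchy interlacing: restricting to a subspace of codimension c loses at
    most c positive squares, since a positive definite subspace loses at most c
    dimensions. *)
Lemma ipos_codim n (H : 'M[F]_n) m (J : 'M[F]_(m, n)) : H \is hermsymmx ->
  (ipos H + \rank J <= ipos (J *m H *m J ^t*) + n)%N.
Proof.
move=> hH; have [V [pV <-]] := posdef_subspace hH.
have pVJ : posdef_on H (V :&: J)%MS.
  by move=> x /submx_trans /(_ (capmxSl _ _)); exact: pV.
have := posdef_restrict_rank hH (capmxSr _ _) pVJ.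
by have := mxrank_sum_cap V J; have := rank_leq_col (V + J)%MS; lia.
Qed.

(** Intersect the row space of J with the nonpositive eigenspan of H: at least
    rank J - ipos H dimensions remain, the form is nonpositive there, and it
    vanishes only on the radical of H. Dividing by that radical leaves a
    negative definite subspace. This is the source of both minimal inertias. *)
Lemma rank_le_ipos_ineg n (H : 'M[F]_n) m (J : 'M[F]_(m, n)) :
  H \is hermsymmx ->
  (\rank (J *m H) <= ipos H + ineg (J *m H *m J ^t*))%N.
Proof.
move=> hH; have [W [rW hW]] := nonpos_subspace hH.
rewrite inegE ?herm_congr // -mulNmx -mulmxN.
pose K := ((W :&: J) :\: kermx H)%MS.
have sK : (K <= W :&: J)%MS by exact: diffmxSl.
have nK : posdef_on (- H) K.
  move=> x xK nx; have /hW[] : (x <= W)%MS.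
    by rewrite (submx_trans xK) // (submx_trans sK) ?capmxSl.
  rewrite qfN oppr_gt0 lt_neqAle => -> h; rewrite andbT.
  apply: contraNneq nx => /h xH.
  rewrite -submx0 -(capmx_diff (W :&: J)%MS (kermx H)) sub_capmx xK.
  by rewrite sub_kermx xH eqxx.
have := posdef_restrict_rank (hermN hH) (submx_trans sK (capmxSr _ _)) nK.
have := mxrank_cap_compl (W :&: J)%MS (kermx H); rewrite -/K.
have := mxrank_sum_cap W J; have := rank_leq_col (W + J)%MS.
have := mxrank_mul_ker J H.
have : (\rank ((W :&: J) :&: kermx H)%MS <= \rank (J :&: kermx H)%MS)%N.
  by rewrite mxrankS // capmxS // capmxSr.
have [V [_ rV]] := posdef_subspace hH; have := rank_leq_row V.
by rewrite rW rV; rank_lia.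
Qed.

End Restriction.

(** * Large semidefinite perturbations *)

Section Perturbation.
Variable F : numClosedFieldType.

Lemma qf_lower_bound n (H : 'M[F]_n) : H \is hermsymmx ->
  exists2 c : F, 0 <= c & forall x, - (c * qf 1%:M x) <= qf H x.
Proof.
move=> /spectral_decomposition[P [d [uP rd ->]]].
exists (\sum_i `|d 0 i|); first by rewrite sumr_ge0.
move=> x; have [z ->] : exists z, x = z *m P.
  exists (x *m P ^t*).
  by rewrite -mulmxA -invmx_unitary // mulVmx ?mulmx1 // unitarymx_unit.
rewrite qf_spectral // (qf_mul P 1%:M) mulmx1.
rewrite (unitarymxP uP) qf1 mulr_sumr -sumrN ler_sum // => i _.
rewrite -mulNr ler_wpM2r ?exprn_ge0 //.
apply: (le_trans (y := - `|d 0 i|)).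
  by rewrite lerN2 (bigD1 i) //= lerDl sumr_ge0.
by rewrite lerNl -normrN real_ler_norm // realN rd.
Qed.

(** Take V positive definite in the kernel of N and, in the H-orthogonal
    complement of V, a subspace Q that meets the kernel of N trivially. On V + Q
    the form splits, the perturbation is zero on V, and N is injective on Q, so
    a large t dominates H there. Choosing Q orthogonal to V avoids
    estimating the cross terms. *)
Lemma ipos_perturb n p (H : 'M[F]_n) (N : 'M[F]_(n, p)) : H \is hermsymmx ->
  exists2 t : F, 0 <= t &
    (\rank N + ipos (kermx N *m H *m (kermx N) ^t*) <=
       ipos (H + t *: (N *m N ^t*)))%N.
Proof.
move=> hH; have [V [sVN pV <-]] := restrict_posdef_subspace (kermx N) hH.
pose K := kermx (H *m V ^t*); pose Q := (K :\: kermx N)%MS.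
have KV x y : (x <= K)%MS -> (y <= V)%MS -> x *m H *m y ^t* = 0.
  move=> /sub_kermxP xK /submxP[z ->].
  by rewrite trmxC_mul mulmxA -(mulmxA x) xK mul0mx.
have VK0 : (V :&: K)%MS = 0.
  apply/eqP; rewrite -submx0; apply/rV_subP => x; rewrite sub_capmx submx0.
  move=> /andP[xV xK]; apply/negPn/negP => /(pV _ xV).
  by rewrite /qf KV // mxE ltxx.
have rQ : (\rank N <= \rank Q)%N.
  have := mxrank_cap_compl K (kermx N); rewrite -/Q.
  have : (V + (K :&: kermx N) <= kermx N)%MS.
    by rewrite addsmx_sub sVN capmxSr.
  move=> /mxrankS; rewrite mxrank_disjoint_sum; last first.
    by apply/eqP; rewrite -submx0 -VK0 capmxS // capmxSl.
  rewrite !mxrank_ker; have := mxrankM_maxr H (V ^t*).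
  rewrite [X in (_ <= X)%N -> _]mxrank_map mxrank_tr.
  have := rank_leq_row N; rank_lia.
(* S inverts N on Q, so H on Q becomes a form in the variable x N. *)
pose S := pinvmx (Q *m N) *m Q.
have QS : Q *m N *m S = Q.
  apply/eqP; rewrite -subr_eq0 -submx0 -(capmx_diff K (kermx N)) sub_capmx -/Q.
  apply/andP; split; first by rewrite addmx_sub ?eqmx_opp ?mulmxA ?submxMl.
  rewrite sub_kermx mulmxBl subr_eq0 /S mulmxA -(mulmxA _ Q N).
  by rewrite mulmxKpV.
have [c c0 hc] := qf_lower_bound (herm_congr S hH).
exists (c + 1); first by rewrite addr_ge0.
have VQ0 : (V :&: Q)%MS = 0.
  by apply/eqP; rewrite -submx0 -VK0 capmxS // diffmxSl.
apply: (@leq_trans (\rank (V + Q)%MS)).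
  by rewrite mxrank_disjoint_sum // addnC leq_add2l.
apply: posdef_rank.
  apply: hermD => //; apply/hermE.
  rewrite trmxC_scale ?(hermE _ (herm_gram N)) //.
  by rewrite ger0_real // addr_ge0.
move=> x /sub_addsmxP[[a b] /= ->] nx; set v := a *m V; set q := b *m Q.
have vV : (v <= V)%MS by exact: submxMl.
have qQ : (q <= Q)%MS by exact: submxMl.
have qK : (q <= K)%MS by exact: submx_trans qQ (diffmxSl _ _).
have vN : v *m N = 0 by apply/sub_kermxP; exact: submx_trans vV sVN.
have qS : q *m N *m S = q by rewrite -!mulmxA (mulmxA Q) QS.
have -> : qf (H + (c + 1) *: (N *m N ^t*)) (v + q) =
          qf H v + (qf H q + (c + 1) * qf 1%:M (q *m N)).
  rewrite qfD qfZ qf_gram mulmxDl vN add0r addrA [v + q]addrC.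
  by rewrite (qfD_orth hH (KV _ _ _ _ qK vV)) [qf H q + _]addrC.
have qpos : qf 1%:M (q *m N) <= qf H q + (c + 1) * qf 1%:M (q *m N).
  rewrite mulrDl mul1r addrA lerDr -[X in qf H X]qS (qf_mul S).
  by rewrite -lerBlDr sub0r.
have [v0|nv] := eqVneq v 0.
  rewrite v0 qf0 add0r; apply: lt_le_trans qpos.
  rewrite lt_def qf1_ge0 andbT qf1_eq0; apply: contraNneq nx => qN0.
  by rewrite -/v -/q v0 add0r -qS qN0 mul0mx.
by rewrite ltr_wpDr ?pV //; apply: le_trans qpos; exact: qf1_ge0.
Qed.

End Perturbation.

(** * Bordered matrices *)

Section BorderedRank.
Variable F : fieldType.

Lemma rank_row_mx m p q (U : 'M[F]_(m, p)) (V : 'M[F]_(m, q)) :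
  \rank (row_mx U V) = (\rank U + \rank (kermx U *m V))%N.
Proof.
have := mxrank_mul_ker (kermx U) V; rewrite mxrank_ker.
have -> : \rank (kermx U :&: kermx V)%MS = \rank (kermx (row_mx U V)).
  apply/eqP; rewrite eqn_leq !mxrankS //; last first.
    by rewrite sub_kermx mul_mx_row; apply/eqP;
      rewrite (sub_kermxP (capmxSl _ _)) (sub_kermxP (capmxSr _ _)) row_mx0.
  have := mulmx_ker (row_mx U V); rewrite mul_mx_row -[RHS]row_mx0.
  by move=> /eq_row_mx[/sub_kermxP hU /sub_kermxP hV]; rewrite sub_capmx hU.
rewrite mxrank_ker; have := rank_leq_row (row_mx U V); have := rank_leq_row U.
by rank_lia.
Qed.

Lemma mul_kermx_col_mx m1 m2 n (A : 'M[F]_(m1, n)) (C : 'M[F]_(m2, n)) :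
  rsubmx (kermx (col_mx A C)) *m C = - (lsubmx (kermx (col_mx A C)) *m A).
Proof.
apply/eqP; rewrite -addr_eq0 addrC -mul_row_col hsubmxK.
by rewrite mulmx_ker.
Qed.

(** Every rank in the theorem that involves both equations has this shape,
    with E the identity, the adjoint of A or the adjoint of C: row operations
    that kill the left block column produce the vectors of the intersection,
    on which X and Y act through their difference only. *)
Lemma rank_coupled m1 m2 n p (A : 'M[F]_(m1, n)) (C : 'M[F]_(m2, n))
    (X Y : 'M[F]_n) (E : 'M[F]_(n, p)) :
  \rank (block_mx A (A *m X *m E) C (C *m Y *m E)) =
    (\rank (col_mx A C) + \rank ((A :&: C)%MS *m (X - Y) *m E))%N.
Proof.
rewrite block_mxEh rank_row_mx; congr (_ + _)%N.
rewrite -{1}[kermx _]hsubmxK mul_row_col !mulmxA mul_kermx_col_mx.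
rewrite -!(mulmxA _ _ E) !mulNmx -mulmxBr -mulmxBl.
by rewrite -(eqmxMr _ (capmxE A C)) mulmxA.
Qed.

End BorderedRank.

Section BorderedInertia.
Variable F : numClosedFieldType.

Lemma rank_herm_conj m n (A : 'M[F]_(m, n)) : \rank (A ^t*) = \rank A.
Proof. by rewrite mxrank_map mxrank_tr. Qed.

Lemma bordered_herm k n (H : 'M[F]_k) (S : 'M[F]_(k, n)) : H \is hermsymmx ->
  block_mx H S (S ^t*) 0 \is hermsymmx.
Proof.
by move=> /hermE hH; apply/hermE; rewrite trmxC_block_mx hH trmxCK trmxC0.
Qed.

(** Each independent row of the border contributes one hyperbolic plane, and
    what remains is H restricted to the vectors that the border kills. The upper
    bound is interlacing on that subspace; for the lower bound, restricting to
    the vectors (x, t x S / 2) turns the form into H + t S S^t*, and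
    [ipos_perturb] applies. *)
Lemma ipos_bordered k n l (H : 'M[F]_k) (S : 'M[F]_(k, n)) (L : 'M[F]_(l, k)) :
  H \is hermsymmx -> (L :=: kermx S)%MS ->
  ipos (block_mx H S (S ^t*) 0) = (\rank S + ipos (L *m H *m L ^t*))%N.
Proof.
move=> hH eqL; have hM := bordered_herm S hH; set M := block_mx _ _ _ _ in hM *.
have LS0 : L *m S = 0 by apply/sub_kermxP; rewrite eqL.
apply/eqP; rewrite eqn_leq; apply/andP; split.
  pose K : 'M[F]_(l + n, k + n) := block_mx L 0 0 1%:M.
  have := ipos_codim K hM; rewrite rank_diag_block_mx mxrank1 eqL mxrank_ker.
  suff : (ipos (K *m M *m K ^t*) <= ipos (L *m H *m L ^t*))%N.
    by have := rank_leq_row S; rank_lia.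
  have -> : K *m M *m K ^t* = col_mx 1%:M 0 *m (L *m H *m L ^t*) *m
                               (col_mx 1%:M (0 : 'M_(n, l))) ^t*.
    rewrite /K /M trmxC_block_mx !mulmx_block.
    rewrite mul_col_mx [in RHS]trmxC_col_mx mul_col_row !(trmxC0, trmxC1).
    rewrite !(mulmx1, mul1mx) !(mulmx0, mul0mx) !(addr0, add0r).
    by rewrite -trmxC_mul LS0 trmxC0.
  by rewrite ipos_congr_le // herm_congr.
have [t t0 ht] := ipos_perturb S hH.
apply: (@leq_trans (ipos (H + t *: (S *m S ^t*)))).
  apply: leq_trans ht; rewrite leq_add2l.
  by apply: ipos_congr_sub => //; rewrite eqL.
have rt : t / 2 \is Num.real by rewrite ger0_real // divr_ge0.
have := ipos_congr_le (row_mx 1%:M ((t / 2) *: S)) hM.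
suff -> : row_mx 1%:M ((t / 2) *: S) *m M *m (row_mx 1%:M ((t / 2) *: S)) ^t*
  = H + t *: (S *m S ^t*) by [].
rewrite trmxC_row_mx trmxC1 trmxC_scale // mul_row_block mul_row_col.
rewrite !mul1mx !mulmx1 mulmx0 addr0 -addrA -scalemxAl -scalemxAr -scalerDl.
by rewrite -splitr.
Qed.

Lemma ineg_bordered k n l (H : 'M[F]_k) (S : 'M[F]_(k, n)) (L : 'M[F]_(l, k)) :
  H \is hermsymmx -> (L :=: kermx S)%MS ->
  ineg (block_mx H S (S ^t*) 0) = (\rank S + ineg (L *m H *m L ^t*))%N.
Proof.
move=> hH eqL; rewrite !inegE ?bordered_herm ?herm_congr //.
have -> : - block_mx H S (S ^t*) 0 = block_mx (- H) (- S) ((- S) ^t*) 0.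
  by rewrite opp_block_mx (trmxC_opp S) oppr0.
rewrite (ipos_bordered (L := L) (hermN hH)) ?mxrank_opp ?mulmxN ?mulNmx //.
apply/eqmxP; rewrite !eqL; apply/andP; split; apply/sub_kermxP.
  by rewrite mulmxN mulmx_ker oppr0.
by apply/eqP; rewrite -oppr_eq0 -mulmxN; apply/eqP; exact: mulmx_ker.
Qed.

Section CouplingMatrix.
Variables (m n : nat) (A C : 'M[F]_(m, n)) (X Y : 'M[F]_n).
Hypotheses (hX : X \is hermsymmx) (hY : Y \is hermsymmx).

Let H := block_mx (A *m X *m A ^t*) 0 0 (- (C *m Y *m C ^t*)).
Let L := kermx (col_mx A C).
Let J := lsubmx L *m A.

Let MmxE : Mmx A (A *m X) C (C *m Y) =
  block_mx H (col_mx A C) ((col_mx A C) ^t*) 0.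
Proof.
by rewrite /Mmx trmxC_col_mx !trmxC_mul (hermE _ hX) (hermE _ hY) !mulmxA.
Qed.

Let hermH : H \is hermsymmx.
Proof.
apply/hermE; rewrite trmxC_block_mx trmxC_opp !trmxC0.
by rewrite !(hermE _ (herm_congr _ _)).
Qed.

Let restrictH : L *m H *m L ^t* = J *m (X - Y) *m J ^t*.
Proof.
rewrite -{1 2}[L]hsubmxK trmxC_row_mx mul_row_block !mulmx0 addr0 add0r.
rewrite mul_row_col mulmxN mulNmx.
have -> : lsubmx L *m (A *m X *m A ^t*) *m (lsubmx L) ^t* = J *m X *m J ^t*.
  by rewrite trmxC_mul !mulmxA.
have -> : rsubmx L *m (C *m Y *m C ^t*) *m (rsubmx L) ^t* = J *m Y *m J ^t*.
  have -> : J *m Y *m J ^t* = (- J) *m Y *m (- J) ^t*.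
    by rewrite trmxC_opp mulmxN !mulNmx opprK.
  by rewrite -mul_kermx_col_mx trmxC_mul !mulmxA.
by rewrite mulmxBr mulmxBl.
Qed.

Let sameJ (Z : 'M[F]_n) : Z \is hermsymmx ->
  ipos (J *m Z *m J ^t*) = ipos ((A :&: C)%MS *m Z *m (A :&: C)%MS ^t*).
Proof.
by move=> hZ; apply/eqP; rewrite eqn_leq !ipos_congr_sub // capmxE.
Qed.

(** The border of M is the stacked matrix of A and C, and its left kernel
    consists of the pairs (u, v) with u A = - v C; on such a pair the two
    diagonal blocks combine to the form X - Y at the vector u A. *)
Lemma ipos_Mmx : ipos (Mmx A (A *m X) C (C *m Y)) =
  (\rank (col_mx A C) +
     ipos ((A :&: C)%MS *m (X - Y) *m (A :&: C)%MS ^t*))%N.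
Proof.
by rewrite MmxE (ipos_bordered (L := L)) // restrictH sameJ // hermB.
Qed.

Lemma ineg_Mmx : ineg (Mmx A (A *m X) C (C *m Y)) =
  (\rank (col_mx A C) +
     ineg ((A :&: C)%MS *m (X - Y) *m (A :&: C)%MS ^t*))%N.
Proof.
have hXY := hermB hX hY.
rewrite MmxE (ineg_bordered (L := L)) // restrictH !inegE ?herm_congr //.
have oppJ k (J' : 'M[F]_(k, n)) : - (J' *m (X - Y) *m J' ^t*) =
    J' *m (- (X - Y)) *m J' ^t* by rewrite mulmxN mulNmx.
by rewrite !oppJ sameJ // hermN.
Qed.

End CouplingMatrix.

End BorderedInertia.

(** * Rank of a restricted matrix *)

Section RestrictedRank.
Variable F : fieldType.

Lemma rank_mul_kermx m n p (A : 'M[F]_(m, n)) (B : 'M[F]_(n, p)) :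
  (\rank (A *m B) + \rank (kermx B) = \rank (A + kermx B)%MS)%N.
Proof.
by have := mxrank_mul_ker A B; have := mxrank_sum_cap A (kermx B); rank_lia.
Qed.

Lemma kermx_cokermx m n (B : 'M[F]_(m, n)) : (kermx (cokermx B) :=: B)%MS.
Proof.
apply/eqmxP/andP; split; last by rewrite sub_kermx mulmx_coker.
by rewrite submxE mulmx_ker.
Qed.

Lemma cokermx_factor m n p (M : 'M[F]_(m, n)) (B : 'M[F]_(n, p)) :
  M *m B = 0 -> exists E, B = cokermx M *m E.
Proof.
move=> MB0.
have sub : ((cokermx M)^T <= kermx M^T)%MS.
  by apply/sub_kermxP; rewrite -trmx_mul mulmx_coker trmx0.
have : (B^T <= (cokermx M)^T)%MS.
  apply: submx_trans (_ : (B^T <= kermx M^T)%MS) _.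
    by apply/sub_kermxP; rewrite -trmx_mul MB0 trmx0.
  rewrite -(geq_leqif (mxrank_leqif_sup sub)).
  by rewrite mxrank_ker !mxrank_tr mxrank_coker.
by move=> /submxP[E BE]; exists E^T; rewrite -[LHS]trmxK BE trmx_mul trmxK.
Qed.

(** Restricting G on the left to the annihilator of v and on the right to the
    annihilator of u removes the rows and columns met by u and v; the rank of
    their common block u G v is removed twice and has to be given back. This is
    the generalised Schur complement without inverses. *)
Lemma rank_restrict m n i j (G : 'M[F]_(m, n)) (u : 'M[F]_(i, m))
    (v : 'M[F]_(n, j)) :
  (\rank (kermx (G *m v) *m G *m cokermx (u *m G))
     + \rank (u *m G) + \rank (G *m v) = \rank G + \rank (u *m G *m v))%N.
Proof.
set W := kermx (G *m v).
have h1 := rank_mul_kermx (W *m G) (cokermx (u *m G)).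
have h2 : \rank (W *m G + kermx (cokermx (u *m G)))%MS =
          \rank ((W + u)%MS *m G).
  by rewrite (adds_eqmx (eqmx_refl _) (kermx_cokermx _)) addsmxMr.
have h3 := rank_mul_kermx (W + u)%MS G.
have h4 : \rank (W + u + kermx G)%MS = \rank (u + W)%MS.
  apply/eqmx_rank/andP; split; last by rewrite addsmxC addsmxSl.
  rewrite addsmx_sub addsmxC submx_refl /= (submx_trans _ (addsmxSr _ _)) //.
  by apply/sub_kermxP; rewrite mulmxA mulmx_ker mul0mx.
have h5 := rank_mul_kermx u (G *m v).
move: h1 h2 h3 h4 h5; rewrite kermx_cokermx !mxrank_ker mulmxA -/W.
have := rank_leq_row G; have := rank_leq_row (G *m v).
by rank_lia.
Qed.

Lemma mul_kermx_solve m n p (P : 'M[F]_(m, n)) (Q : 'M[F]_(m, p)) :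
  kermx P *m Q = 0 -> exists X, P *m X = Q.
Proof.
move=> kQ; exists (pinvmx P *m Q); rewrite mulmxA.
have : (1%:M - P *m pinvmx P <= kermx P)%MS.
  by apply/sub_kermxP; rewrite mulmxBl mul1mx mulmxKpV ?subrr.
move=> /submxP[E /(congr1 (mulmx^~ Q))].
by rewrite -mulmxA kQ mulmx0 mulmxBl mul1mx => /eqP; rewrite subr_eq0 => /eqP.
Qed.

End RestrictedRank.

(** * Hermitian completions of minimal rank *)

Section MinimalRank.
Variable F : numClosedFieldType.

(** Project along C onto a complement that contains a complement of A :&: C
    in A, so that the row space of A is preserved as well. *)
Lemma projection_along n m1 m2 (A : 'M[F]_(m1, n)) (C : 'M[F]_(m2, n)) :
  exists p : 'M[F]_n, [/\ C *m p = 0, (1%:M - p <= C)%MS & (A *m p <= A)%MS].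
Proof.
pose U := ((A :\: C) + (A + C)^C)%MS; pose V := <<C>>%MS.
have sC : (C <= U + V)%MS by apply: submx_trans (addsmxSr _ _); rewrite genmxE.
have sD : (A :\: C <= U)%MS by exact: addsmxSl.
have decA : (A <= (A :\: C) + (A :&: C))%MS by rewrite addsmx_diff_cap_eq.
have fUV : (1%:M <= U + V)%MS.
  have := addsmx_compl_full (A + C)%MS; rewrite -sub1mx => /submx_trans-> //.
  rewrite !addsmx_sub sC (submx_trans (addsmxSr _ _) (addsmxSl _ _)) !andbT.
  rewrite (submx_trans decA) // addsmx_sub (submx_trans sD) ?addsmxSl //=.
  exact: submx_trans (capmxSr _ _) sC.
have UV0 : (U :&: V = 0)%MS.
  apply/eqP; rewrite -mxrank_eq0.
  have := mxrank_sum_cap U V; have := mxrank_sum_cap A C.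
  have := mxrank_cap_compl A C.
  have := mxrank_adds_leqif (A :\: C)%MS (A + C)^C%MS => -[+ _].
  have := mxrank_compl (A + C)%MS; have := rank_leq_col (A + C)%MS.
  move: fUV; rewrite sub1mx => /eqP ->.
  rewrite /V mxrank_gen -/U; rank_lia.
exists (proj_mx U V); split.
- by rewrite proj_mx_0 ?genmxE.
- by have := proj_mx_compl_sub fUV; rewrite mul1mx genmxE.
apply: submx_trans (submxMr _ decA) _; rewrite addsmxMr addsmx_sub.
rewrite proj_mx_id // diffmxSl /= proj_mx_0 ?sub0mx // genmxE.
exact: capmxSr.
Qed.

(** The converse holds trivially. For p the projection along C of
    [projection_along], the part p D p^t* is killed by C; the rest is killed by
    A, because A D sees only the projected vectors and A D C^t* = 0. *)
Lemma herm_split n m1 m2 (A : 'M[F]_(m1, n)) (C : 'M[F]_(m2, n)) (D : 'M[F]_n) :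
  D \is hermsymmx -> A *m D *m C ^t* = 0 -> (A :&: C)%MS *m D = 0 ->
  exists K1 K2 : 'M[F]_n, [/\ K1 \is hermsymmx, K2 \is hermsymmx,
    A *m K1 = 0, C *m K2 = 0 & D = K1 - K2].
Proof.
move=> hD ADC JD; have [p [Cp pC pA]] := projection_along A C.
exists (D - p *m D *m p ^t*), (- (p *m D *m p ^t*)); split.
- by rewrite hermB ?herm_congr.
- by rewrite hermN ?herm_congr.
- have /submxP[E AE] : (A - A *m p <= A :&: C)%MS.
    rewrite sub_capmx addmx_sub ?eqmx_opp //=.
    by rewrite -{1}[A]mulmx1 -mulmxBr (submx_trans (submxMl _ _)).
  have AD : A *m D = A *m p *m D.
    by apply/eqP; rewrite -subr_eq0 -mulmxBl AE -mulmxA JD mulmx0.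
  have /submxP[E' pE] := pC.
  rewrite mulmxBr !mulmxA -AD -{1}[A *m D]mulmx1 -mulmxBr.
  by rewrite -(trmxC1 F n) -trmxC_sub pE trmxC_mul mulmxA ADC mul0mx.
- by rewrite mulmxN !mulmxA Cp !mul0mx oppr0.
- by rewrite opprK subrK.
Qed.

(** A form k on the coordinates of W that ignores the vectors of A extends to
    the whole space: solve A X = 0 and W X = k, and conjugate by X a Hermitian
    generalised inverse of k. *)
Lemma herm_extend n m w (A : 'M[F]_(m, n)) (W : 'M[F]_(w, n)) (k : 'M[F]_w) :
  k \is hermsymmx ->
  (forall p (y : 'M[F]_(p, w)), (y *m W <= A)%MS -> y *m k = 0) ->
  exists K : 'M[F]_n, [/\ K \is hermsymmx, A *m K = 0 & W *m K *m W ^t* = k].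
Proof.
move=> hk ky.
have [X] : exists X, col_mx A W *m X = col_mx 0 k.
  apply: mul_kermx_solve.
  rewrite -[kermx _]hsubmxK mul_row_col mulmx0 add0r ky //.
  by rewrite mul_kermx_col_mx eqmx_opp submxMl.
rewrite mul_col_mx => /eq_col_mx[AX WX].
have [g kgk] : exists g, k *m g *m k = k by exists (pinvmx k); rewrite mulmxKpV.
have kgk' : k *m g ^t* *m k = k.
  by rewrite -[in RHS](hermE _ hk) -[in RHS]kgk !trmxC_mul (hermE _ hk) mulmxA.
exists (X *m (g *m k *m g ^t*) *m X ^t*); split.
- by rewrite !herm_congr.
- by rewrite !mulmxA AX !mul0mx.
have XW : X ^t* *m W ^t* = k by rewrite -trmxC_mul WX (hermE _ hk).
by rewrite !mulmxA WX kgk -(mulmxA _ (X ^t*)) XW.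
Qed.

(** When a :&: b is in the radical, only the off-diagonal block P = a G b^t* is
    prescribed. A full rank factorisation P = L R gives the solution Z = T T^t*
    with a T = L and b T = R^t*, in the manner of completing
    [? L R; (L R)^t* ?] by [L L^t*, L R; (L R)^t*, R^t* R]. *)
Lemma min_rank_disjoint n m1 m2 (a : 'M[F]_(m1, n)) (b : 'M[F]_(m2, n))
    (G : 'M[F]_n) : G \is hermsymmx -> (a :&: b)%MS *m G = 0 ->
  exists Z : 'M[F]_n, [/\ Z \is hermsymmx,
    (\rank Z <= \rank (a *m G *m b ^t*))%N,
    a *m Z *m b ^t* = a *m G *m b ^t* & (a :&: b)%MS *m Z = 0].
Proof.
move=> hG radG; set P := a *m G *m b ^t*.
pose L := col_base P; pose R := row_base P.
have LR : L *m R = P by exact: mulmx_base.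
have freeL : row_free (L ^t*).
  by rewrite -row_leq_rank rank_herm_conj (eqP (col_base_full P)).
(* This makes a T = L, b T = R^t* solvable, and makes the solution vanish on
   a :&: b. *)
have LR0 q (u : 'M[F]_(q, m1)) (v : 'M[F]_(q, m2)) :
    u *m a = v *m b -> u *m L = 0 /\ v *m R ^t* = 0.
  move=> uv; have : (u *m a <= a :&: b)%MS.
    by rewrite sub_capmx submxMl uv submxMl.
  move=> /submxP[s us].
  have uG : u *m a *m G = 0 by rewrite us -mulmxA radG mulmx0.
  split; apply/eqP.
    rewrite -(mulmx_free_eq0 _ (row_base_free P)) -mulmxA LR.
    by rewrite /P !mulmxA uG mul0mx.
  rewrite -(mulmx_free_eq0 _ freeL) -mulmxA -trmxC_mul LR /P herm_conj //.
  by rewrite !mulmxA -uv uG mul0mx.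
have [T] : exists T, col_mx a b *m T = col_mx L (R ^t*).
  apply: mul_kermx_solve; rewrite -[kermx _]hsubmxK mul_row_col.
  have [|-> h] := LR0 _ (lsubmx (kermx (col_mx a b)))
                        (- rsubmx (kermx (col_mx a b))).
    by rewrite mulNmx mul_kermx_col_mx opprK.
  by rewrite add0r -[LHS]opprK -mulNmx h oppr0.
rewrite mul_col_mx => /eq_col_mx[aT bT].
exists (T *m T ^t*); split.
- exact: herm_gram.
- by rewrite (leq_trans (mxrankM_maxl _ _)) // rank_leq_col.
- by rewrite mulmxA aT -mulmxA -trmxC_mul bT trmxCK LR.
have /submxP[u ua] := capmxSl a b; have /submxP[v vb] := capmxSr a b.
have [uL _] := LR0 _ u v (etrans (esym ua) vb).
by rewrite mulmxA {1}ua -(mulmxA u) aT uL mul0mx.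
Qed.

(** Let W be the orthogonal of J with respect to G. Since J G is fixed, the
    rank of an admissible Z is that of its restriction to W up to a constant
    ([rank_restrict]). On W the intersection of A and C lies in the radical, so
    [min_rank_disjoint] gives an optimal form; [herm_split] and [herm_extend]
    realise it by admissible corrections of G. The resulting rank, that of G
    between the parts of A and C in W, is computed by [rank_restrict] again. *)
Lemma min_rank_coupled n m1 m2 (A : 'M[F]_(m1, n)) (C : 'M[F]_(m2, n))
    (G : 'M[F]_n) (J := (A :&: C)%MS) : G \is hermsymmx ->
  exists K1 K2 : 'M[F]_n, [/\ K1 \is hermsymmx, K2 \is hermsymmx,
    A *m K1 = 0, C *m K2 = 0 &
    (\rank (G + K1 - K2)%R + \rank (J *m G *m A ^t*) + \rank (J *m G *m C ^t*)
      <= 2 * \rank (J *m G) + \rank (A *m G *m C ^t*))%N].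
Proof.
move=> hG.
(* The three kernels are kept behind their characterisations: kermx unfolds to
   a product, into which mulmxA would otherwise reassociate. *)
have [W defW] : exists W, W = kermx (G *m J ^t*) by exists (kermx (G *m J ^t*)).
have WGJ : W *m G *m J ^t* = 0 by rewrite defW -mulmxA mulmx_ker.
have [a subA] : exists a : 'M[F]_n, forall p (y : 'M[F]_(p, n)),
    (y <= a)%MS = (y *m W <= A)%MS.
  by exists (kermx (W *m cokermx A)) => p y; rewrite sub_kermx mulmxA submxE.
have [b subC] : exists b : 'M[F]_n, forall p (y : 'M[F]_(p, n)),
    (y <= b)%MS = (y *m W <= C)%MS.
  by exists (kermx (W *m cokermx C)) => p y; rewrite sub_kermx mulmxA submxE.
have JGW : J *m G *m W ^t* = 0 by rewrite -(herm_conj _ _ hG) WGJ trmxC0.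
pose H := W *m G *m W ^t*; have hH : H \is hermsymmx by exact: herm_congr.
have radH : (a :&: b)%MS *m H = 0.
  have /submxP[s sE] : ((a :&: b)%MS *m W <= J)%MS.
    by rewrite sub_capmx -subA -subC capmxSl capmxSr.
  by rewrite /H !mulmxA sE -!(mulmxA s) JGW mulmx0.
have [Z' [hZ' rZ' aZb radZ]] := min_rank_disjoint hH radH.
have [||k1 [k2 [hk1 hk2 ak1 bk2 Dk]]] :=
  herm_split (hermB hZ' hH) (_ : a *m _ *m b ^t* = 0) _.
- by rewrite mulmxBr mulmxBl aZb subrr.
- by rewrite mulmxBr radZ radH subrr.
have [|K1 [hK1 AK1 WK1]] := @herm_extend _ _ _ A W k1 hk1.
  by move=> p y; rewrite -subA => /submxP[z ->]; rewrite -mulmxA ak1 mulmx0.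
have [|K2 [hK2 CK2 WK2]] := @herm_extend _ _ _ C W k2 hk2.
  by move=> p y; rewrite -subC => /submxP[z ->]; rewrite -mulmxA bk2 mulmx0.
exists K1, K2; split=> //; set Z := G + K1 - K2.
have hZ : Z \is hermsymmx by rewrite hermB ?hermD.
have WZ : W *m Z *m W ^t* = Z'.
  by rewrite mulmxBr mulmxDr mulmxBl mulmxDl WK1 WK2 -addrA -Dk addrC subrK.
have /submxP[u uA] : (J <= A)%MS by exact: capmxSl.
have /submxP[v vC] : (J <= C)%MS by exact: capmxSr.
have JZ : J *m Z = J *m G.
  rewrite mulmxBr mulmxDr.
  by rewrite {2}uA {2}vC -!mulmxA AK1 CK2 !mulmx0 addr0 subr0.
have ZJ : Z *m J ^t* = G *m J ^t*.
  by rewrite -(hermE _ hZ) -trmxC_mul JZ trmxC_mul (hermE _ hG).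
have := rank_restrict Z J (J ^t*); rewrite JZ ZJ -defW.
have : (\rank (W *m Z *m cokermx (J *m G)) <= \rank Z')%N.
  have /submxP[E EW] : ((cokermx (J *m G)) ^t* <= W)%MS.
    rewrite defW; apply/sub_kermxP.
    have -> : G *m J ^t* = (J *m G) ^t* by rewrite trmxC_mul (hermE _ hG).
    by rewrite -trmxC_mul mulmx_coker trmxC0.
  by rewrite -[cokermx _]trmxCK EW trmxC_mul mulmxA WZ mxrankM_maxl.
pose P := A *m G *m C ^t*.
have uP : u *m P = J *m G *m C ^t* by rewrite /P !mulmxA -uA.
have vJ q (Q : 'M[F]_(q, n)) : Q *m C ^t* *m v ^t* = Q *m J ^t*.
  by rewrite -mulmxA -trmxC_mul -vC.
have Pv : P *m v ^t* = A *m G *m J ^t* by exact: vJ.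
have := rank_restrict P u (v ^t*); rewrite uP Pv vJ.
have : (\rank (a *m H *m b ^t*) <=
    \rank (kermx (A *m G *m J ^t*) *m P *m cokermx (J *m G *m C ^t*)))%N.
  have /submxP[x xE] : (a *m W <= A)%MS by rewrite -subA.
  have /submxP[y yE] : (b *m W <= C)%MS by rewrite -subC.
  have -> : a *m H *m b ^t* = x *m P *m y ^t*.
    rewrite /H /P !mulmxA xE -(mulmxA _ (W ^t*)) -trmxC_mul yE trmxC_mul.
    by rewrite !mulmxA.
  have /submxP[x' ->] : (x <= kermx (A *m G *m J ^t*))%MS.
    by apply/sub_kermxP; rewrite !mulmxA -xE -(mulmxA a) -mulmxA WGJ mulmx0.
  have [E ->] : exists E, y ^t* = cokermx (J *m G *m C ^t*) *m E.
    apply: cokermx_factor; rewrite -mulmxA -trmxC_mul -yE trmxC_mul mulmxA.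
    by rewrite JGW mul0mx.
  rewrite mulmxA (leq_trans (mxrankM_maxl _ _)) // -(mulmxA x') -mulmxA.
  exact: mxrankM_maxr.
have -> : \rank (A *m G *m J ^t*) = \rank (J *m G *m A ^t*).
  by rewrite -(herm_conj _ _ hG) rank_herm_conj.
have -> : \rank (G *m J ^t*) = \rank (J *m G).
  by rewrite -[RHS]rank_herm_conj trmxC_mul (hermE _ hG).
move: rZ'; rewrite -/P; rank_lia.
Qed.

End MinimalRank.

(** * Bounds for coupled Hermitian matrices *)

Section DifferenceInertia.
Variable F : numClosedFieldType.

Lemma ipos_leq n (H : 'M[F]_n) : H \is hermsymmx -> (ipos H <= n)%N.
Proof. by move=> /posdef_subspace[V [_ <-]]; exact: rank_leq_row. Qed.

Lemma inegN n (H : 'M[F]_n) : H \is hermsymmx -> ineg (- H) = ipos H.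
Proof. by move=> hH; rewrite inegE ?hermN // opprK. Qed.

Lemma pdmx_ipos n (H : 'M[F]_n) : H \is hermsymmx -> pdmx H <-> ipos H = n.
Proof.
move=> hH; split=> [[_ pH]|iH].
  apply/eqP; rewrite eqn_leq ipos_leq //=.
  rewrite -[X in (X <= _)%N](mxrank1 F); apply: posdef_rank => // x _ nx.
  have := pH (x ^t*); rewrite trmxCK; apply.
  by apply: contraNneq nx => x0; rewrite -[x]trmxCK x0 trmxC0.
split=> // v nv; have [V [pV rV]] := posdef_subspace hH.
have := pV (v ^t*); rewrite /qf trmxCK; apply.
  by rewrite submx_full // /row_full rV iH.
by apply: contraNneq nv => v0; rewrite -[v]trmxCK v0 trmxC0.
Qed.

Lemma psdmx_ineg n (H : 'M[F]_n) : H \is hermsymmx -> psdmx H <-> ineg H = 0%N.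
Proof.
move=> hH; rewrite inegE //; split=> [[_ pH]|iH].
  have [V [pV <-]] := posdef_subspace (hermN hH).
  apply/eqP; rewrite mxrank_eq0; apply/negPn/negP => /rowV0Pn[x xV nx].
  have := pV x xV nx; rewrite qfN oppr_gt0.
  have := pH (x ^t*); rewrite trmxCK => /le_lt_trans h /h.
  by rewrite ltxx.
split=> // v; have [W [rW hW]] := nonpos_subspace (hermN hH).
have [] := hW (v ^t*).
  by rewrite submx_full // /row_full rW iH subn0.
by rewrite qfN oppr_le0 /qf trmxCK.
Qed.

(** The correction by t times the sum of the Gram matrices of the cokernels of A
    and C is admissible, and as a form it vanishes exactly on A :&: C. *)
Lemma max_ipos_coupled n m1 m2 (A : 'M[F]_(m1, n)) (C : 'M[F]_(m2, n))
    (G : 'M[F]_n) (J := (A :&: C)%MS) : G \is hermsymmx ->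
  exists K1 K2 : 'M[F]_n, [/\ K1 \is hermsymmx, K2 \is hermsymmx,
    A *m K1 = 0, C *m K2 = 0 &
    (n + ipos (J *m G *m J ^t*) <= \rank J + ipos (G + K1 - K2)%R)%N].
Proof.
move=> hG; pose Na := cokermx A; pose Nc := cokermx C.
have [t t0] := ipos_perturb (row_mx Na Nc) hG.
have herm_t (N : 'M[F]_n) : t *: (N *m N ^t*) \is hermsymmx.
  apply/hermE; rewrite trmxC_scale ?(hermE _ (herm_gram N)) //.
  by rewrite ger0_real.
have eqJ : (J :=: kermx (row_mx Na Nc))%MS.
  have sJ p (x : 'M_(p, n)) : (x <= kermx (row_mx Na Nc))%MS = (x <= J)%MS.
    by rewrite sub_kermx sub_capmx !submxE mul_mx_row row_mx_eq0.
  by apply/eqmxP/andP; split; [rewrite sJ | rewrite -sJ].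
move=> h; exists (t *: (Na *m Na ^t*)), (- (t *: (Nc *m Nc ^t*))); split.
- exact: herm_t.
- by rewrite hermN.
- by rewrite -scalemxAr mulmxA mulmx_coker mul0mx scaler0.
- by rewrite mulmxN -scalemxAr mulmxA mulmx_coker mul0mx scaler0 oppr0.
have -> : G + t *: (Na *m Na ^t*) - - (t *: (Nc *m Nc ^t*)) =
    G + t *: (row_mx Na Nc *m (row_mx Na Nc) ^t*).
  by rewrite opprK trmxC_row_mx mul_row_col scalerDr addrA.
apply: leq_trans (leq_add (leqnn _) h).
rewrite eqJ mxrank_ker addnA subnK ?rank_leq_row // leq_add2l.
by apply: ipos_congr_sub; rewrite ?eqJ.
Qed.

Section CoupledBounds.
Variables (n m1 m2 : nat) (A : 'M[F]_(m1, n)) (C : 'M[F]_(m2, n)).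
Variables (G Z : 'M[F]_n).
Hypotheses (hG : G \is hermsymmx) (hZ : Z \is hermsymmx).
Let J := (A :&: C)%MS.
Hypotheses (JZ : J *m Z = J *m G) (AZC : A *m Z *m C ^t* = A *m G *m C ^t*).

Lemma coupled_ipos_le : (ipos Z + \rank J <= ipos (J *m G *m J ^t*) + n)%N.
Proof. by rewrite -JZ ipos_codim. Qed.

Lemma coupled_ipos_ge : (\rank (J *m G) <= ipos Z + ineg (J *m G *m J ^t*))%N.
Proof. by rewrite -JZ rank_le_ipos_ineg. Qed.

Lemma coupled_rank_le : (\rank Z + \rank J <= \rank (J *m G) + n)%N.
Proof. by have := mxrank_mul_min J Z; rewrite JZ; rank_lia. Qed.

(** Two Frobenius inequalities: one passes from Z to its rows in A, the other
    from those rows to their pairing with C. *)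
Lemma coupled_rank_ge : (2 * \rank (J *m G) + \rank (A *m G *m C ^t*) <=
  \rank Z + \rank (J *m G *m A ^t*) + \rank (J *m G *m C ^t*))%N.
Proof.
have /submxP[u uA] : (J <= A)%MS by exact: capmxSl.
have := mxrank_Frobenius u (A *m Z) (C ^t*).
have := mxrank_Frobenius A Z (J ^t*).
have -> : \rank (A *m Z *m J ^t*) = \rank (J *m G *m A ^t*).
  by rewrite -(herm_conj _ _ hZ) rank_herm_conj JZ.
have -> : \rank (Z *m J ^t*) = \rank (J *m G).
  by rewrite -[RHS]rank_herm_conj -JZ trmxC_mul (hermE _ hZ).
rewrite !mulmxA -uA AZC JZ; rank_lia.
Qed.

End CoupledBounds.

(** From one solution P B, the correction by the projection onto the kernel of A
    makes the solution Hermitian, since P A (P B)^t* already is. *)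
Lemma hermsol_exists m n (A B : 'M[F]_(m, n)) :
  colrange B `<=` colrange A -> A *m B ^t* = B *m A ^t* -> hermsol A B !=set0.
Proof.
move=> rBA AB.
have [P APA] : exists P, A *m P *m A = A by exists (pinvmx A); rewrite mulmxKpV.
have APB : A *m P *m B = B.
  apply/matrixP => i j.
  have /rBA[x _ xE] : colrange B (col j B).
    by exists (delta_mx j 0) => //; rewrite colE.
  have : A *m P *m col j B = col j B by rewrite -xE mulmxA APA.
  by rewrite colE mulmxA -!colE => /colP/(_ i); rewrite !mxE.
exists (P *m B + (1%:M - P *m A) *m (P *m B) ^t*); split.
  apply/hermE.
  have e : P *m A *m (P *m B) ^t* = P *m (A *m B ^t*) *m P ^t*.
    by rewrite trmxC_mul !mulmxA.
  have he : (P *m A *m (P *m B) ^t*) ^t* = P *m A *m (P *m B) ^t*.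
    by rewrite e !trmxC_mul !trmxCK -AB !mulmxA.
  rewrite mulmxBl mul1mx trmxC_add trmxC_sub trmxCK he.
  by rewrite addrCA.
rewrite mulmxDr !mulmxA APB mulmxBr mulmx1 !mulmxA APA subrr mul0mx.
by rewrite addr0.
Qed.

Lemma colrange_mul m n p (A : 'M[F]_(m, n)) (X : 'M[F]_(n, p)) :
  colrange (A *m X) `<=` colrange A.
Proof. by move=> _ [x _ <-]; exists (X *m x); rewrite ?mulmxA. Qed.

Lemma hermsol_symm m n (A B : 'M[F]_(m, n)) (Y : 'M[F]_n) :
  hermsol A B Y -> A *m B ^t* = B *m A ^t*.
Proof. by move=> [/hermE hY <-]; rewrite trmxC_mul hY mulmxA. Qed.

End DifferenceInertia.

(** * Differences of Hermitian solutions *)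

Section Extremes.
Variables (F : numClosedFieldType) (n : nat) (S T : set 'M[F]_n).

Lemma diffvals_max (f : 'M[F]_n -> nat) (k : int) :
  (exists X Y, [/\ S X, T Y & (f (X - Y))%:Z = k]) ->
  (forall X Y, S X -> T Y -> (f (X - Y))%:Z <= k) ->
  is_max (diffvals S T f) k.
Proof.
move=> [X [Y [SX TY fk]]] fle; split; first by exists X, Y.
by move=> _ [X' [Y' [SX' TY' ->]]]; exact: fle.
Qed.

Lemma diffvals_min (f : 'M[F]_n -> nat) (k : int) :
  (exists X Y, [/\ S X, T Y & (f (X - Y))%:Z = k]) ->
  (forall X Y, S X -> T Y -> k <= (f (X - Y))%:Z) ->
  is_min (diffvals S T f) k.
Proof.
move=> [X [Y [SX TY fk]]] fge; split; first by exists X, Y.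
by move=> _ [X' [Y' [SX' TY' ->]]]; exact: fge.
Qed.

End Extremes.

Section Solutions.
Variables (F : numClosedFieldType) (m n : nat) (A C : 'M[F]_(m, n)).
Variables (X0 Y0 : 'M[F]_n).
Hypotheses (hX0 : X0 \is hermsymmx) (hY0 : Y0 \is hermsymmx).
Local Notation S := (hermsol A (A *m X0)).
Local Notation T := (hermsol C (C *m Y0)).
Local Notation G := (X0 - Y0).
Local Notation J := (A :&: C)%MS.

(** A vector of J lies in both row spaces, so it sees only A X and C Y; in
    the pairing with C, the Hermitian Y can be moved to the right factor. *)
Lemma hermsol_diff X Y : S X -> T Y ->
  [/\ X - Y \is hermsymmx, J *m (X - Y) = J *m G
    & A *m (X - Y) *m C ^t* = A *m G *m C ^t*].
Proof.
move=> [hX AX] [hY CY]; split; first exact: hermB.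
- have /submxP[u uA] : (J <= A)%MS by exact: capmxSl.
  have /submxP[v vC] : (J <= C)%MS by exact: capmxSr.
  have -> : J *m (X - Y) = u *m (A *m X) - v *m (C *m Y).
    by rewrite !mulmxA -uA -vC mulmxBr.
  by rewrite AX CY !mulmxA -uA -vC mulmxBr.
- have YC (W : 'M[F]_n) : W \is hermsymmx ->
    A *m W *m C ^t* = A *m (C *m W) ^t*.
    by move=> /hermE hW; rewrite trmxC_mul hW mulmxA.
  by rewrite !mulmxBr !mulmxBl AX (YC Y) // CY -YC.
Qed.

Lemma hermsol_shift K1 K2 : K1 \is hermsymmx -> K2 \is hermsymmx ->
  A *m K1 = 0 -> C *m K2 = 0 ->
  exists X Y, [/\ S X, T Y & X - Y = G + K1 - K2].
Proof.
move=> hK1 hK2 AK1 CK2; exists (X0 + K1), (Y0 + K2); split.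
- by split; rewrite ?hermD // mulmxDr AK1 addr0.
- by split; rewrite ?hermD // mulmxDr CK2 addr0.
- by rewrite opprD addrACA addrA.
Qed.

Let hG : G \is hermsymmx. Proof. exact: hermB. Qed.

Local Notation p := (ipos (J *m G *m J ^t*)).
Local Notation q := (ineg (J *m G *m J ^t*)).
Local Notation r := (\rank (J *m G)).

Lemma hermsol_bounds X Y : S X -> T Y ->
  [/\ (ipos (X - Y)%R + \rank J <= n + p)%N, (r <= ipos (X - Y)%R + q)%N,
      (ineg (X - Y)%R + \rank J <= n + q)%N, (r <= ineg (X - Y)%R + p)%N
    & (\rank (X - Y)%R + \rank J <= n + r)%N].
Proof.
move=> SX TY; have [hZ JZ _] := hermsol_diff SX TY.
have JNZ : J *m (- (X - Y)) = J *m (- G) by rewrite !mulmxN JZ.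
have oppJ : J *m (- G) *m J ^t* = - (J *m G *m J ^t*) by rewrite mulmxN mulNmx.
have hJ := herm_congr J hG.
have pE : p = ineg (J *m (- G) *m J ^t*) by rewrite oppJ inegN.
have qE : q = ipos (J *m (- G) *m J ^t*) by rewrite oppJ -inegE.
have rE : r = \rank (J *m (- G)) by rewrite mulmxN mxrank_opp.
split.
- by rewrite [X in (_ <= X)%N]addnC (coupled_ipos_le hZ JZ).
- exact: coupled_ipos_ge.
- rewrite (inegE hZ) qE [X in (_ <= X)%N]addnC.
  by rewrite (coupled_ipos_le (hermN hZ) JNZ).
- by rewrite (inegE hZ) pE rE (coupled_ipos_ge (hermN hZ) JNZ).
- by rewrite [X in (_ <= X)%N]addnC; exact: coupled_rank_le.
Qed.

Lemma hermsol_max_ipos :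
  exists X Y, [/\ S X, T Y & (n + p <= \rank J + ipos (X - Y)%R)%N].
Proof.
have [K1 [K2 [hK1 hK2 AK1 CK2 h]]] := max_ipos_coupled A C hG.
have [X [Y [SX TY XY]]] := hermsol_shift hK1 hK2 AK1 CK2.
by exists X, Y; rewrite XY.
Qed.

Lemma hermsol_max_ineg :
  exists X Y, [/\ S X, T Y & (n + q <= \rank J + ineg (X - Y)%R)%N].
Proof.
have [K1 [K2 [hK1 hK2 AK1 CK2 h]]] := max_ipos_coupled A C (hermN hG).
have [||X [Y [SX TY XY]]] := hermsol_shift (hermN hK1) (hermN hK2).
- by rewrite mulmxN AK1 oppr0.
- by rewrite mulmxN CK2 oppr0.
exists X, Y; split=> //.
have -> : ineg (X - Y) = ipos (- G + K1 - K2).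
  rewrite XY inegE ?hermB ?hermD ?hermN //.
  by congr ipos; rewrite [in LHS]opprD opprK [in LHS]opprD opprK.
have -> : ineg (J *m G *m J ^t*) = ipos (J *m (- G) *m J ^t*).
  by rewrite inegE ?herm_congr // mulmxN mulNmx.
exact: h.
Qed.

Lemma hermsol_min_rank : exists X Y, [/\ S X, T Y &
  (\rank (X - Y)%R + \rank (J *m G *m A ^t*) + \rank (J *m G *m C ^t*)
     <= 2 * r + \rank (A *m G *m C ^t*))%N].
Proof.
have [K1 [K2 [hK1 hK2 AK1 CK2 h]]] := min_rank_coupled A C hG.
have [X [Y [SX TY XY]]] := hermsol_shift hK1 hK2 AK1 CK2.
by exists X, Y; rewrite XY.
Qed.

Lemma hermsol_rank_ge X Y : S X -> T Y ->
  (2 * r + \rank (A *m G *m C ^t*) <=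
    \rank (X - Y)%R + \rank (J *m G *m A ^t*) + \rank (J *m G *m C ^t*))%N.
Proof.
by move=> SX TY; have [hZ JZ AZC] := hermsol_diff SX TY; exact: coupled_rank_ge.
Qed.

End Solutions.

Lemma hermsol_common (F : numClosedFieldType) m n (A B C D : 'M[F]_(m, n)) :
  hermsol A B `&` hermsol C D = hermsol (col_mx A C) (col_mx B D).
Proof.
apply/seteqP; split=> X /=.
  by move=> [[hX AX] [_ CX]]; split; rewrite // mul_col_mx AX CX.
by move=> [hX]; rewrite mul_col_mx => /eq_col_mx[].
Qed.

Ltac by_bounds b := case: b => -[]; rank_lia.

Theorem theorem3p1 (R : realType) (m n : nat) (A B C D : 'M[R[i]]_(m, n))
    (solvAB : hermsol A B !=set0) (solvCD : hermsol C D !=set0) :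
  let S := hermsol A B in
  let T := hermsol C D in
  let M := Mmx A B C D in
  let N := block_mx A B C D in
  let r1 := \rank (block_mx A (B *m A ^t*) C (D *m A ^t*)) in
  let r2 := \rank (block_mx A (B *m C ^t*) C (D *m C ^t*)) in
  let r0 := \rank (A *m D ^t* - B *m C ^t*) in
  (is_max (diffvals S T (fun Z => \rank Z))
     (n%:Z + (\rank N)%:Z - (\rank A)%:Z - (\rank C)%:Z)) /\
  (is_min (diffvals S T (fun Z => \rank Z))
     (2 * (\rank N)%:Z + r0%:Z - r1%:Z - r2%:Z)) /\
  (is_max (diffvals S T (@ipos _ n))
     (n%:Z + (ipos M)%:Z - (\rank A)%:Z - (\rank C)%:Z)) /\
  (is_max (diffvals S T (@ineg _ n))
     (n%:Z + (ineg M)%:Z - (\rank A)%:Z - (\rank C)%:Z)) /\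
  (is_min (diffvals S T (@ipos _ n)) ((\rank N)%:Z - (ineg M)%:Z)) /\
  (is_min (diffvals S T (@ineg _ n)) ((\rank N)%:Z - (ipos M)%:Z)) /\
  (* (a) *)
  ((exists X Y, [/\ S X, T Y & X - Y \in unitmx]) <->
    (\rank N = \rank A + \rank C)%N) /\
  (* (b) *)
  ((forall X Y, S X -> T Y -> X - Y \in unitmx) <->
    (2 * \rank N + r0 = r1 + r2 + n)%N) /\
  (* (c) *)
  (S `&` T !=set0 <->
    (colrange (col_mx B D) `<=` colrange (col_mx A C) /\
     col_mx A C *m row_mx (B ^t*) (D ^t*)
       = col_mx B D *m row_mx (A ^t*) (C ^t*))) /\
  (* (d) *)
  ((exists X Y, [/\ S X, T Y & pdmx (X - Y)]) <->
    (ipos M = \rank A + \rank C)%N) /\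
  ((exists X Y, [/\ S X, T Y & pdmx (Y - X)]) <->
    (ineg M = \rank A + \rank C)%N) /\
  (* (e) *)
  ((forall X Y, S X -> T Y -> pdmx (X - Y)) <->
    (ineg M)%:Z = (\rank N)%:Z - n%:Z) /\
  ((forall X Y, S X -> T Y -> pdmx (Y - X)) <->
    (ipos M)%:Z = (\rank N)%:Z - n%:Z) /\
  (* (f) *)
  ((exists X Y, [/\ S X, T Y & psdmx (X - Y)]) <-> ipos M = \rank N) /\
  ((exists X Y, [/\ S X, T Y & psdmx (Y - X)]) <-> ineg M = \rank N) /\
  (* (g) *)
  ((forall X Y, S X -> T Y -> psdmx (X - Y)) <->
    (ineg M)%:Z = (\rank A)%:Z + (\rank C)%:Z - n%:Z) /\
  ((forall X Y, S X -> T Y -> psdmx (Y - X)) <->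
    (ipos M)%:Z = (\rank A)%:Z + (\rank C)%:Z - n%:Z).
Proof.
case: solvAB => X0 [hX0 AX0]; case: solvCD => Y0 [hY0 CY0].
subst B D; move=> S T M N r1 r2 r0.
pose G := X0 - Y0; pose J := (A :&: C)%MS; pose rho := \rank (col_mx A C).
pose p := ipos (J *m G *m J ^t*); pose q := ineg (J *m G *m J ^t*).
pose r := \rank (J *m G); pose d := \rank J.
pose e1 := \rank (J *m G *m A ^t*); pose e2 := \rank (J *m G *m C ^t*).
have rN : \rank N = (rho + r)%N.
  by have := rank_coupled A C X0 Y0 1%:M; rewrite !mulmx1.
have pM : ipos M = (rho + p)%N by exact: ipos_Mmx.
have qM : ineg M = (rho + q)%N by exact: ineg_Mmx.
have r1E : r1 = (rho + e1)%N by exact: rank_coupled.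
have r2E : r2 = (rho + e2)%N by exact: rank_coupled.
have r0E : r0 = \rank (A *m G *m C ^t*).
  rewrite /r0 trmxC_mul (hermE _ hY0) mulmxA -mxrank_opp opprB.
  by rewrite -mulmxBl -mulmxBr.
have dE : (rho + d)%N = (\rank A + \rank C)%N.
  by rewrite -mxrank_sum_cap addsmxE.
have r_le : (r <= d)%N by exact: mxrankM_maxl.
have herm_diff X Y : S X -> T Y -> X - Y \is hermsymmx.
  by move=> [hX _] [hY _]; exact: hermB.
have bounds X Y : S X -> T Y ->
    [/\ [/\ (ipos (X - Y)%R + d <= n + p)%N, (r <= ipos (X - Y)%R + q)%N,
            (ineg (X - Y)%R + d <= n + q)%N & (r <= ineg (X - Y)%R + p)%N],
        (ipos (X - Y)%R + ineg (X - Y)%R)%N = \rank (X - Y)%R,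
        (2 * r + r0 <= \rank (X - Y)%R + e1 + e2)%N,
        (\rank (X - Y)%R + d <= n + r)%N
      & (\rank (X - Y)%R <= n)%N].
  move=> SX TY; have [b1 b2 b3 b4 b5] := hermsol_bounds hX0 hY0 SX TY.
  split; [by split | | | exact: b5 | exact: rank_leq_row].
    exact: iposDineg (herm_diff _ _ SX TY).
  by rewrite r0E; exact: hermsol_rank_ge.
have [Xp [Yp [SXp TYp hp]]] : exists X Y,
    [/\ S X, T Y & (n + p <= d + ipos (X - Y)%R)%N] by exact: hermsol_max_ipos.
have [Xq [Yq [SXq TYq hq]]] : exists X Y,
    [/\ S X, T Y & (n + q <= d + ineg (X - Y)%R)%N] by exact: hermsol_max_ineg.
have [Xr [Yr [SXr TYr hr]]] : exists X Y,
    [/\ S X, T Y & (\rank (X - Y)%R + e1 + e2 <= 2 * r + r0)%N].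
  by rewrite r0E; exact: hermsol_min_rank.
have rank_unit X Y : S X -> T Y -> (X - Y \in unitmx) = (\rank (X - Y)%R == n).
  by move=> _ _; rewrite -row_free_unit.
have pd_diff X Y : S X -> T Y -> pdmx (X - Y) <-> ipos (X - Y) = n.
  by move=> SX TY; apply: pdmx_ipos; exact: herm_diff.
have psd_diff X Y : S X -> T Y -> psdmx (X - Y) <-> ineg (X - Y) = 0%N.
  by move=> SX TY; apply: psdmx_ineg; exact: herm_diff.
have nd_diff X Y : S X -> T Y -> pdmx (Y - X) <-> ineg (X - Y) = n.
  move=> SX TY; rewrite (inegE (herm_diff _ _ SX TY)) opprB.
  by apply: pdmx_ipos; rewrite -opprB hermN ?herm_diff.
have nsd_diff X Y : S X -> T Y -> psdmx (Y - X) <-> ipos (X - Y) = 0%N.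
  move=> SX TY; rewrite -(inegN (herm_diff _ _ SX TY)) opprB.
  by apply: psdmx_ineg; rewrite -opprB hermN ?herm_diff.
(* Apart from (c), the claims now follow by linear arithmetic. *)
clearbody N M r0 r1 r2 p q r d e1 e2 rho.
have at_p := bounds _ _ SXp TYp; have at_q := bounds _ _ SXq TYq.
have at_r := bounds _ _ SXr TYr.
(* The extremal differences also bound p and q, which the equivalences need:
   an equality between ranks has to be read off one inequality. *)
have p_le : (p <= d)%N /\ (p <= r)%N.
  by move: hp; by_bounds at_p.
have q_le : (q <= d)%N /\ (q <= r)%N.
  by move: hq; by_bounds at_q.
rewrite {}rN {}pM {}qM {}r1E {}r2E.
move: (\rank A) (\rank C) dE => ra rc dE.
split.
  apply: diffvals_max.
    by exists Xp, Yp; split=> //; move: hp; by_bounds at_p.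
  by move=> X Y SX TY; by_bounds (bounds _ _ SX TY).
split.
  apply: diffvals_min.
    by exists Xr, Yr; split=> //; move: hr; by_bounds at_r.
  by move=> X Y SX TY; by_bounds (bounds _ _ SX TY).
split.
  apply: diffvals_max.
    by exists Xp, Yp; split=> //; move: hp; by_bounds at_p.
  by move=> X Y SX TY; by_bounds (bounds _ _ SX TY).
split.
  apply: diffvals_max.
    by exists Xq, Yq; split=> //; move: hq; by_bounds at_q.
  by move=> X Y SX TY; by_bounds (bounds _ _ SX TY).
split.
  apply: diffvals_min.
    by exists Xq, Yq; split=> //; move: hq; by_bounds at_q.
  by move=> X Y SX TY; by_bounds (bounds _ _ SX TY).
split.
  apply: diffvals_min.
    by exists Xp, Yp; split=> //; move: hp; by_bounds at_p.
  by move=> X Y SX TY; by_bounds (bounds _ _ SX TY).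
split.
  split=> [[X [Y [SX TY]]]|e].
    rewrite rank_unit // => /eqP.
    by_bounds (bounds _ _ SX TY).
  exists Xp, Yp; split=> //.
  by rewrite rank_unit //; apply/eqP; move: hp; by_bounds at_p.
split.
  split=> [/(_ _ _ SXr TYr)|e X Y SX TY].
    by rewrite rank_unit // => /eqP; move: hr; by_bounds at_r.
  rewrite rank_unit //; apply/eqP.
  by_bounds (bounds _ _ SX TY).
split.
  rewrite /S /T hermsol_common -!trmxC_col_mx; split=> [[X solX]|[]].
    split; last exact: hermsol_symm solX.
    by case: solX => _ <-; exact: colrange_mul.
  exact: hermsol_exists.
split.
  split=> [[X [Y [SX TY]]]|e].
    move=> /(pd_diff _ _ SX TY).
    by_bounds (bounds _ _ SX TY).
  exists Xp, Yp; split=> //; apply/(pd_diff _ _ SXp TYp).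
  by move: hp; by_bounds at_p.
split.
  split=> [[X [Y [SX TY]]]|e].
    move=> /(nd_diff _ _ SX TY).
    by_bounds (bounds _ _ SX TY).
  exists Xq, Yq; split=> //; apply/(nd_diff _ _ SXq TYq).
  by move: hq; by_bounds at_q.
split.
  split=> [/(_ _ _ SXq TYq)/(pd_diff _ _ SXq TYq)|e X Y SX TY].
    by move: hq; by_bounds at_q.
  apply/(pd_diff _ _ SX TY).
  by_bounds (bounds _ _ SX TY).
split.
  split=> [/(_ _ _ SXp TYp)/(nd_diff _ _ SXp TYp)|e X Y SX TY].
    by move: hp; by_bounds at_p.
  apply/(nd_diff _ _ SX TY).
  by_bounds (bounds _ _ SX TY).
split.
  split=> [[X [Y [SX TY]]]|e].
    move=> /(psd_diff _ _ SX TY).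
    by_bounds (bounds _ _ SX TY).
  exists Xp, Yp; split=> //; apply/(psd_diff _ _ SXp TYp).
  by move: hp; by_bounds at_p.
split.
  split=> [[X [Y [SX TY]]]|e].
    move=> /(nsd_diff _ _ SX TY).
    by_bounds (bounds _ _ SX TY).
  exists Xq, Yq; split=> //; apply/(nsd_diff _ _ SXq TYq).
  by move: hq; by_bounds at_q.
split.
  split=> [/(_ _ _ SXq TYq)/(psd_diff _ _ SXq TYq)|e X Y SX TY].
    by move: hq; by_bounds at_q.
  apply/(psd_diff _ _ SX TY).
  by_bounds (bounds _ _ SX TY).
split=> [/(_ _ _ SXp TYp)/(nsd_diff _ _ SXp TYp)|e X Y SX TY].
  by move: hp; by_bounds at_p.
apply/(nsd_diff _ _ SX TY).
by_bounds (bounds _ _ SX TY).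
Qed.
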